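(* Let $G$ be a non-empty finite simple graph on $n$ vertices and let $W\subseteq V(G)$ with $|W|=\sigma$, $0\le\sigma\le n$. Let $G_W$ be the graph obtained from $G$ by attaching a self-loop at each vertex of $W$. Then $$\mathcal{SE}(G)-2\sigma\left(1-\frac{\sigma}{n}\right)\;\le\;\mathcal{SE}(G_W)\;\le\;\mathcal{SE}(G)+2\sigma\left(1-\frac{\sigma}{n}\right).$$ Moreover, equality holds in the left-hand inequality if and only if $\sigma=0$ or $\sigma=n$, and equality holds in the right-hand inequality if and only if $\sigma=0$ or $\sigma=n$.
   Context: ''Non-empty'' is meant in the usual graph-theoretic sense: $G$ has at least one edge. The Seidel matrix $S(G)=[s_{ij}]$ of a simple graph $G$ with vertices $v_1,\dots,v_n$ is the real symmetric $n\times n$ matrix with $s_{ii}=0$ for all $i$ and, for $i\ne j$, $s_{ij}=-1$ if $v_i,v_j$ are adjacent and $s_{ij}=1$ if they are non-adjacent. The Seidel energy of $G$ is $\mathcal{SE}(G)=\sum_{i=1}^n|\theta_i(G)|$, where $\theta_1(G),\dots,\theta_n(G)$ are the eigenvalues of $S(G)$ (with multiplicity). For $W\subseteq V(G)$ with $|W|=\sigma$, the Seidel matrix of the self-loop graph $G_W$ is $S(G_W)=S(G)-\mathfrak{I}_W$, where $\mathfrak{I}_W$ is the diagonal $n\times n$ matrix whose $(i,i)$ entry is $1$ if $v_i\in W$ and $0$ otherwise. The Seidel energy of $G_W$ is $\mathcal{SE}(G_W)=\sum_{i=1}^n\left|\theta_i(G_W)+\frac{\sigma}{n}\right|$, where $\theta_1(G_W),\dots,\theta_n(G_W)$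 are the eigenvalues of $S(G_W)$ (with multiplicity). *)

(* Defs.v *)
From mathcomp Require Import all_boot all_order all_algebra.
From mathcomp Require Import polyrcf.

Set Implicit Arguments.
Unset Strict Implicit.
Unset Printing Implicit Defensive.

Import Order.TTheory GRing.Theory Num.Theory.
Local Open Scope ring_scope.

Record sgraph (n : nat) := SGraph {
  adj : rel 'I_n;
  adj_sym : symmetric adj;
  adj_irr : irreflexive adj }.

Definition nonempty_graph n (G : sgraph n) : Prop := exists u v, adj G u v.

(* The eigenvalues of A lying in R, each repeated according to its algebraic  *)
(* multiplicity; for a symmetric A over a real closed field this is the whole *)
(* spectrum, i.e. a sequence of length n.                                     *)
Definition eigenvalues (R : rcfType) n (A : 'M[R]_n) : seq R :=
  flatten [seq nseq (mup x (char_poly A)) x | x <- rootsR (char_poly A)].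

Definition seidel (R : rcfType) n (G : sgraph n) : 'M[R]_n :=
  \matrix_(i, j) if i == j then 0 else if adj G i j then -1 else 1.

Definition loop_mx (R : rcfType) n (W : {set 'I_n}) : 'M[R]_n :=
  diag_mx (\row_i (i \in W)%:R).

(* The self-loop graph G_W is represented by the pair (G, W). *)
Definition seidel_loop (R : rcfType) n (G : sgraph n) (W : {set 'I_n}) :
  'M[R]_n := seidel R G - loop_mx R W.

Definition seidel_energy (R : rcfType) n (G : sgraph n) : R :=
  \sum_(t <- eigenvalues (seidel R G)) `|t|.

Definition seidel_loop_energy (R : rcfType) n (G : sgraph n)
    (W : {set 'I_n}) : R :=
  \sum_(t <- eigenvalues (seidel_loop R G W)) `|t + #|W|%:R / n%:R|.

(* Main.v *)
(* With D the diagonal matrix of entries sigma / n - [v_i \in W], the energies *)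
(* SE(G) and SE(G_W) are the nuclear norms of S and S + D, and D has nuclear   *)
(* norm 2 sigma (1 - sigma / n); the bounds are the triangle inequality. The   *)
(* norm of S + D is tr (U (S + D)) for the phase U of S + D, and equality      *)
(* requires U to be dual to S and to D too. If 0 < sigma < n then D is         *)
(* invertible, which forces U to be the diagonal sign matrix of D. Since S has *)
(* zero diagonal, tr (U S) = 0: on the right this gives S = 0; on the left,    *)
(* where the two matrices are S + D and - D, it gives a negative norm.         *)
Require Import Defs.
From mathcomp Require Import all_boot all_order all_algebra.
From mathcomp Require Import complex polyrcf spectral ring.
Import Order.TTheory GRing.Theory Num.Theory.
Local Open Scope ring_scope.
Local Open Scope sesquilinear_scope.

(** Over [R[i]], a shifted symmetric matrix is unitarily diagonal and its energy is its nuclear norm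
    ([shifted_spectral]). The duality bound |tr (U A)| <= ||A||, for a unitary conjugate U of a
    diagonal contraction ([norm_trace_mul_le]), gives the triangle inequality
    [nuclear_norm_addD_le]. Its equality case [nuclear_norm_addD_eq] rests on
    [unitary_diag_entry_eq1], which forces U to be diagonal. Both results are applied to S + D and
    to (S + D) + (- D). *)

(** * Nuclear norm of a diagonal perturbation *)

Section NuclearNorm.

Context {C : numClosedFieldType} {n : nat}.
Implicit Types (P Q U A : 'M[C]_n) (s t u d : 'rV[C]_n).

Lemma unitary_diagE P s j k :
  (P^t* *m diag_mx s *m P) j k = \sum_i s 0 i * ((P i j)^* * P i k).
Proof.
rewrite mul_mx_diag mxE; apply: eq_bigr => i _.
by rewrite !mxE mulrAC mulrC mulrA.
Qed.

(** The entry [(j, j)] of [U *m U^t*] is a mean of the squared moduli of [s], weighted by the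
    squared moduli of the unit column [j] of [P]. *)
Lemma unitary_diag_row_le1 P s j : P \is unitarymx ->
    (forall i, `|s 0 i| <= 1) ->
  \sum_k `|(P^t* *m diag_mx s *m P) j k| ^+ 2 <= 1.
Proof.
move=> Pu s_le1; set U := _ *m P.
have PE : P^t* *m P = 1%:M by rewrite -[P^t*]mul1mx mulmxKtV.
have UUE : U *m U^t* = P^t* *m diag_mx (\row_i `|s 0 i| ^+ 2) *m P.
  rewrite /U !trmx_mul !map_mxM /= trmxCK tr_diag_mx map_diag_mx !mulmxA.
  rewrite mulmxtVK // -!mulmxA; congr (_ *m _); rewrite !mulmxA mulmx_diag.
  by congr (diag_mx _ *m _); apply/rowP => i; rewrite !mxE normCK.
have -> : \sum_k `|U j k| ^+ 2 = (U *m U^t*) j j.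
  by rewrite mxE; apply: eq_bigr => k _; rewrite !mxE normCK.
have PEjj : (P^t* *m P) j j = 1 by rewrite PE mxE eqxx.
rewrite -[leRHS]PEjj UUE unitary_diagE mxE ler_sum // => i _.
by rewrite !mxE -normCKC ler_piMl ?exprn_ge0 // exprn_ile1.
Qed.

Lemma unitary_diag_entry_le1 P s j : P \is unitarymx ->
    (forall i, `|s 0 i| <= 1) ->
  `|(P^t* *m diag_mx s *m P) j j| <= 1.
Proof.
move=> Pu s_le1; rewrite -(@expr_le1 _ 2) //.
apply: le_trans (unitary_diag_row_le1 _ _ j Pu s_le1).
by rewrite (bigD1 j) //= ler_wpDr // sumr_ge0 // => k _; rewrite exprn_ge0.
Qed.

(** The diagonal entry alone exhausts the bound 1 on the squared norm of its row. *)
Lemma unitary_diag_entry_eq1 P s j k : P \is unitarymx ->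
    (forall i, `|s 0 i| <= 1) ->
    `|(P^t* *m diag_mx s *m P) j j| = 1 -> k != j ->
  (P^t* *m diag_mx s *m P) j k = 0.
Proof.
move=> Pu s_le1 Ujj k_neq_j; have := unitary_diag_row_le1 _ _ j Pu s_le1.
rewrite (bigD1 j) //= Ujj expr1n gerDl (bigD1 k) //= => le0.
apply/eqP; rewrite -normr_eq0 -sqrf_eq0 eq_le exprn_ge0 // andbT.
apply: le_trans le0.
by rewrite ler_wpDr // sumr_ge0 // => l _; rewrite exprn_ge0.
Qed.

Lemma mxtrace_mul_diag A d : \tr (A *m diag_mx d) = \sum_i A i i * d 0 i.
Proof. by apply: eq_bigr => i _; rewrite mul_mx_diag mxE. Qed.

Lemma norm_trace_mul_diag_le P s j d : P \is unitarymx ->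
    (forall i, `|s 0 i| <= 1) ->
  `|(P^t* *m diag_mx s *m P) j j * d 0 j| <= `|d 0 j|.
Proof.
move=> Pu s_le1; rewrite normrM ler_piMl //.
exact: unitary_diag_entry_le1.
Qed.

(** In the eigenbasis of the second factor, the trace is the sum of the [t 0 i] weighted by diagonal
    entries of a contraction. *)
Lemma norm_trace_mul_le P Q s t : P \is unitarymx -> Q \is unitarymx ->
    (forall i, `|s 0 i| <= 1) ->
  `|\tr ((P^t* *m diag_mx s *m P) *m (Q^t* *m diag_mx t *m Q))|
    <= \sum_i `|t 0 i|.
Proof.
move=> Pu Qu s_le1; rewrite mulmxA mxtrace_mulC !mulmxA.
set X := P *m Q^t*.
have -> : Q *m P^t* *m diag_mx s *m P *m Q^t* = X^t* *m diag_mx s *m X.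
  by rewrite /X trmx_mul map_mxM /= trmxCK !mulmxA.
rewrite mxtrace_mul_diag; apply: le_trans (ler_norm_sum _ _ _) _.
apply: ler_sum => i _; apply: norm_trace_mul_diag_le => //.
by rewrite mul_unitarymx // trmxC_unitary.
Qed.

Context {P Q : 'M[C]_n} {t u d : 'rV[C]_n}.
Hypotheses (Pu : P \is unitarymx) (Qu : Q \is unitarymx).
Let A := P^t* *m diag_mx t *m P.
Hypothesis addE : A + diag_mx d = Q^t* *m diag_mx u *m Q.

(* Since [0^-1 = 0], [s 0 i = 0] when [u 0 i = 0]. *)
Let s := \row_i (`|u 0 i| / u 0 i).
Let U := Q^t* *m diag_mx s *m Q.

Let s_le1 i : `|s 0 i| <= 1.
Proof.
rewrite mxE normf_div normr_id; have [->|u_neq0] := eqVneq (u 0 i) 0.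
  by rewrite normr0 mul0r.
by rewrite divff ?normr_eq0.
Qed.

(** Multiplication by [U] turns each eigenvalue [u 0 i] of [A + diag_mx d] into its modulus. *)
Let traceE : \tr (U *m A) + \sum_i U i i * d 0 i = \sum_i `|u 0 i|.
Proof.
rewrite -mxtrace_mul_diag -raddfD /= -mulmxDr addE mulmxA mxtrace_mulC.
rewrite /U !mulmxA (unitarymxP _) // mul1mx mulmxtVK // mulmx_diag mxtrace_diag.
apply: eq_bigr => i _; rewrite !mxE.
by have [->|u_neq0] := eqVneq (u 0 i) 0; rewrite ?normr0 ?mulr0 ?divfK.
Qed.

Lemma nuclear_norm_addD_le :
  \sum_i `|u 0 i| <= \sum_i `|t 0 i| + \sum_i `|d 0 i|.
Proof.
have u_ge0 : 0 <= \sum_i `|u 0 i| by apply: sumr_ge0.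
rewrite -(ger0_norm u_ge0) -traceE; apply: le_trans (ler_normD _ _) _.
apply: lerD; first exact: norm_trace_mul_le.
apply: le_trans (ler_norm_sum _ _ _) _; apply: ler_sum => i _.
exact: norm_trace_mul_diag_le.
Qed.

(* Equality forces the phase [U] of [A + diag_mx d] to be dual to [diag_mx d] *)
(* as well; as all [d 0 i] are nonzero, [U] is then the phase of              *)
(* [diag_mx d].                                                               *)
Lemma nuclear_norm_addD_eq : (forall i, d 0 i != 0) ->
    \sum_i `|u 0 i| = \sum_i `|t 0 i| + \sum_i `|d 0 i| ->
  \sum_i `|t 0 i| = \sum_i `|d 0 i| / d 0 i * A i i.
Proof.
move=> d_neq0 eq_u.
(* Each trace in [F] is bounded in modulus by its norm in [G]. The sums over [bool] agree, so
   [normC_sum_upper] gives equality term by term. *)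
pose F (b : bool) := if b then \tr (U *m A) else \sum_i U i i * d 0 i.
pose G (b : bool) := if b then \sum_i `|t 0 i| else \sum_i `|d 0 i|.
have FG b : F b = G b.
  apply: (@normC_sum_upper _ _ predT F G) => // [[] _|].
  - exact: norm_trace_mul_le.
  - apply: le_trans (ler_norm_sum _ _ _) _; apply: ler_sum => i _.
    exact: norm_trace_mul_diag_le.
  - by rewrite !big_bool /= traceE.
(* The same rigidity, now inside the diagonal trace. *)
have Ud i : U i i * d 0 i = `|d 0 i|.
  apply: (normC_sum_upper _ (FG false)) => // j _.
  exact: norm_trace_mul_diag_le.
have Ujj i : U i i = `|d 0 i| / d 0 i by rewrite -Ud mulfK.
have <- : \tr (U *m A) = \sum_i `|t 0 i| := FG true.
apply: eq_bigr => i _.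
rewrite mxE (bigD1 i) //= big1 ?addr0 ?Ujj // => k k_neq_i.
rewrite /U unitary_diag_entry_eq1 ?mul0r // -/U Ujj normf_div normr_id.
by rewrite divff ?normr_eq0.
Qed.

End NuclearNorm.

(** * Real spectra and shifted energies *)

Lemma char_poly_conj (K : comNzRingType) n (P A B : 'M[K]_n) : P *m A = 1%:M ->
  char_poly (A *m B *m P) = char_poly B.
Proof.
move=> PA1; have AP1 := mulmx1C PA1; rewrite /char_poly.
have -> : char_poly_mx (A *m B *m P) =
    map_mx polyC A *m char_poly_mx B *m map_mx polyC P.
  rewrite /char_poly_mx !map_mxM mulmxBr mulmxBl; congr (_ - _).
  by rewrite mul_mx_scalar -scalemxAl -map_mxM AP1 map_mx1 scalemx1.
by rewrite !det_mulmx mulrAC -det_mulmx -map_mxM AP1 map_mx1 det1 mul1r.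
Qed.

Section RealSpectrum.

Context {R : rcfType}.

(** Shows that [eigenvalues] misses nothing when the characteristic polynomial splits over [R]. *)
Lemma flatten_roots_prod_XsubC (s : seq R)
    (p := \prod_(x <- s) ('X - x%:P)) :
  perm_eq (flatten [seq nseq (mup x p) x | x <- rootsR p]) s.
Proof.
have p_neq0 : p != 0 by rewrite monic_neq0 // monic_prod_XsubC.
apply: perm_trans (perm_count_undup s); apply: perm_flatten.
under eq_map do rewrite mu_prod_XsubC; apply: perm_map.
rewrite uniq_perm ?undup_uniq // ?uniq_roots // => x.
by rewrite mem_undup -(roots_on_rootsR p_neq0) in_itv /= root_prod_XsubC.
Qed.

(** Over [R[i]] the matrix is hermitian, hence unitarily diagonal with real eigenvalues. The
    factored characteristic polynomial descends to [R] because the embedding is injective on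
    polynomials. *)
Lemma symmetric_spectral n (A : 'M[R]_n) : A^T = A ->
  exists2 P : 'M[R[i]]_n, P \is unitarymx & exists2 t : 'rV[R]_n,
    map_mx (real_complex R) A =
      P^t* *m diag_mx (map_mx (real_complex R) t) *m P &
    perm_eq (eigenvalues A) [seq t 0 i | i <- enum 'I_n].
Proof.
move=> A_sym; set Ac := map_mx _ A.
have Ac_herm : Ac \is hermsymmx.
  apply/is_hermitianmxP; rewrite scale1r; apply/matrixP => i j.
  rewrite !mxE -[in LHS]A_sym mxE.
  by apply/esym/conj_Creal/complex_realP; exists (A j i).
have Pu := spectral_unitarymx Ac; set P := spectralmx Ac in Pu.
have AcE : Ac = P^t* *m diag_mx (spectral_diag Ac) *m P.
  by rewrite -invmx_unitary //; apply/orthomx_spectralP/hermitian_normalmx.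
pose t := \row_i complex.Re (spectral_diag Ac 0 i).
have tE : map_mx (real_complex R) t = spectral_diag Ac.
  apply/rowP => i; rewrite !mxE RRe_real //.
  exact: mxOverP (hermitian_spectral_diag_real Ac_herm) _ _.
exists P => //; exists t; rewrite ?tE //.
have charE : char_poly A =
    \prod_(x <- [seq t 0 i | i <- enum 'I_n]) ('X - x%:P).
  apply: (@map_poly_inj _ _ (real_complex R)).
  rewrite map_char_poly /= -/Ac AcE char_poly_conj ?(unitarymxP _) //.
  rewrite char_poly_trig ?diag_mx_is_trig // rmorph_prod big_map big_enum /=.
  apply: eq_bigr => i _.
  by rewrite rmorphB /= map_polyX map_polyC /= -tE !mxE eqxx mulr1n.
by rewrite /eigenvalues charE; exact: flatten_roots_prod_XsubC.
Qed.

(** Common form of both energies: the shift is 0 for G and sigma / n for the self-loop graph. *)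
Definition shifted_energy {n} (A : 'M[R]_n) (a : R) : R :=
  \sum_(x <- eigenvalues A) `|x + a|.

Lemma shifted_spectral {n} (A : 'M[R]_n) a : A^T = A ->
  exists2 P : 'M[R[i]]_n, P \is unitarymx & exists2 t : 'rV[R]_n,
    map_mx (real_complex R) (A + a%:M) =
      P^t* *m diag_mx (map_mx (real_complex R) t) *m P &
    shifted_energy A a = \sum_i `|t 0 i|.
Proof.
move=> /symmetric_spectral[P Pu [t AE eigA]].
have PE : P^t* *m P = 1%:M by rewrite -[P^t*]mul1mx mulmxKtV.
exists P => //; exists (t + const_mx a).
  rewrite map_mxD AE map_mxD raddfD /= mulmxDr mulmxDl; congr (_ + _).
  rewrite map_const_mx diag_const_mx map_scalar_mx mul_mx_scalar -scalemxAl PE.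
  by rewrite scalemx1.
rewrite /shifted_energy (perm_big _ eigA) big_map big_enum /=.
by apply: eq_bigr => i _; rewrite !mxE.
Qed.

Lemma shifted_energy_eq0 n (A : 'M[R]_n) a : A^T = A ->
  shifted_energy A a = 0 -> A + a%:M = 0.
Proof.
move=> /(@shifted_spectral _ _ a)[P _ [t AE ->]] /psumr_eq0P t_eq0.
apply: (map_mx_inj (f := real_complex R)); rewrite AE map_mx0.
suff -> : t = 0 by rewrite map_mx0 linear0 mulmx0 mul0mx.
by apply/rowP => i; rewrite mxE; apply/normr0_eq0/t_eq0.
Qed.

Lemma sum_norm_real_complex n (t : 'rV[R]_n) :
  \sum_i `|map_mx (real_complex R) t 0 i| = (\sum_i `|t 0 i|)%:C%C.
Proof.
rewrite rmorph_sum; apply: eq_bigr => i _.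
by rewrite mxE normc_def /= expr0n addr0 sqrtr_sqr.
Qed.

Section AddDiag.

Context {n : nat} {A B : 'M[R]_n} {a b : R} {d : 'rV[R]_n}.
Hypotheses (A_sym : A^T = A) (B_sym : B^T = B).
Hypothesis BE : A + a%:M + diag_mx d = B + b%:M.

Lemma shifted_energy_addD_le :
  shifted_energy B b <= shifted_energy A a + \sum_i `|d 0 i|.
Proof.
have [P Pu [t AE ->]] := shifted_spectral _ a A_sym.
have [Q Qu [u BbE ->]] := shifted_spectral _ b B_sym.
rewrite -lecR rmorphD /= -!sum_norm_real_complex.
apply: (nuclear_norm_addD_le Pu Qu).
by rewrite -AE -map_diag_mx -map_mxD BE.
Qed.

(** The right-hand side is the trace of [A + a%:M] against the sign matrix of [d], so only the
    diagonal of [A] enters. *)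
Lemma shifted_energy_addD_eq : (forall i, d 0 i != 0) ->
    shifted_energy B b = shifted_energy A a + \sum_i `|d 0 i| ->
  shifted_energy A a = \sum_i `|d 0 i| / d 0 i * (A i i + a).
Proof.
have [P Pu [t AE ->]] := shifted_spectral _ a A_sym.
have [Q Qu [u BbE ->]] := shifted_spectral _ b B_sym.
move=> d_neq0 /(congr1 (real_complex R)).
rewrite rmorphD /= -!sum_norm_real_complex => eq_u.
apply: (@complexI R); rewrite -sum_norm_real_complex.
have addE : P^t* *m diag_mx (map_mx (real_complex R) t) *m P
    + diag_mx (map_mx (real_complex R) d)
    = Q^t* *m diag_mx (map_mx (real_complex R) u) *m Q.
  by rewrite -AE -map_diag_mx -map_mxD BE.
rewrite (nuclear_norm_addD_eq Pu Qu addE) // => [|i]; last first.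
  by rewrite mxE fmorph_eq0.
rewrite rmorph_sum; apply: eq_bigr => i _; rewrite -AE.
rewrite !mxE eqxx mulr1n !rmorphM fmorphV normc_def /= expr0n addr0.
by rewrite sqrtr_sqr.
Qed.

End AddDiag.

End RealSpectrum.

(** * Seidel matrices and the diagonal shift *)

Section Seidel.

Context {R : rcfType} {n : nat}.
Implicit Types (G : sgraph n) (W : {set 'I_n}).

Lemma trmx_seidel G : (seidel R G)^T = seidel R G.
Proof. by apply/matrixP => i j; rewrite !mxE eq_sym adj_sym. Qed.

Lemma trmx_seidel_loop G W : (seidel_loop R G W)^T = seidel_loop R G W.
Proof. by rewrite /seidel_loop linearB /= trmx_seidel tr_diag_mx. Qed.

Lemma seidel_neq0 G : nonempty_graph G -> seidel R G != 0.
Proof.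
case=> u [v uv]; apply/eqP => /matrixP/(_ u v); rewrite !mxE uv.
have [u_eq_v|_ /eqP] := eqVneq u v; last by rewrite oppr_eq0 oner_eq0.
by rewrite u_eq_v adj_irr in uv.
Qed.

Definition loop_shift W : 'rV[R]_n :=
  \row_i (#|W|%:R / n%:R - (i \in W)%:R).

Lemma seidel_add_loop_shift G W :
  seidel R G + diag_mx (loop_shift W) =
  seidel_loop R G W + (#|W|%:R / n%:R)%:M.
Proof.
rewrite /seidel_loop /loop_mx -addrA; congr (_ + _); apply/matrixP => i j.
by rewrite !mxE mulrnBl addrC.
Qed.

Lemma sum_norm_loop_shift W :
  \sum_i `|loop_shift W 0 i| = 2 * #|W|%:R * (1 - #|W|%:R / n%:R).
Proof.
set c := #|W|%:R / n%:R : R.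
have W_le : (#|W| <= n)%N by rewrite -[leqRHS]card_ord max_card.
(* If [n] is 0 then [W] is empty, and both sides vanish. *)
have cn : c * n%:R = #|W|%:R.
  have [W0|W_gt0] := posnP #|W|; first by rewrite /c W0 !mul0r.
  by rewrite divfK // pnatr_eq0 -lt0n (leq_trans W_gt0).
have c_ge0 : 0 <= c by rewrite divr_ge0.
have c_le1 : c <= 1.
  have [W0|W_gt0] := posnP #|W|; first by rewrite /c W0 mul0r.
  by rewrite ler_pdivrMr ?ltr0n ?(leq_trans W_gt0) // mul1r ler_nat.
(* As 0 <= [c] <= 1, the modulus is 1 - [c] on [W] and [c] elsewhere, which is affine in the
   indicator of [W]. *)
transitivity (\sum_i (c + (i \in W)%:R * (1 - 2 * c))).
  apply: eq_bigr => i _; rewrite mxE -/c; case: (i \in W) => /=.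
    by rewrite ler0_norm ?subr_le0 //; ring.
  by rewrite subr0 ger0_norm //; ring.
rewrite big_split /= sumr_const card_ord -[c *+ n]mulr_natr cn -mulr_suml.
have -> : \sum_i ((i \in W)%:R : R) = #|W|%:R.
  rewrite -sum1_card natr_sum [RHS]big_mkcond /=.
  by apply: eq_bigr => i _; case: ifP.
by ring.
Qed.

(** After multiplication by [n], a zero entry would make [#|W|] equal to 0 or [n]. *)
Lemma loop_shift_neq0 W i : (0 < #|W| < n)%N -> loop_shift W 0 i != 0.
Proof.
case/andP=> W_gt0 W_ltn; rewrite mxE subr_eq0.
have n_neq0 : n%:R != 0 :> R by rewrite pnatr_eq0 -lt0n (ltn_trans W_gt0).
rewrite -(inj_eq (mulIf n_neq0)) divfK // -natrM eqr_nat.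
by case: (i \in W); rewrite ?mul1n ?mul0n neq_ltn ?W_gt0 ?W_ltn ?orbT.
Qed.

Lemma seidel_energyE G : seidel_energy R G = shifted_energy (seidel R G) 0.
Proof. by apply: eq_bigr => x _; rewrite addr0. Qed.

Lemma seidel_loop_energyE G W :
  seidel_loop_energy R G W =
  shifted_energy (seidel_loop R G W) (#|W|%:R / n%:R).
Proof. by []. Qed.

End Seidel.

Theorem theorem3p1 (R : rcfType) (n : nat) (G : sgraph n)
    (W : {set 'I_n}) (sigma : nat)
    (G_nonempty : nonempty_graph G) (card_W : #|W| = sigma) :
  let d : R := 2 * sigma%:R * (1 - sigma%:R / n%:R) in
  [/\ seidel_energy R G - d <= seidel_loop_energy R G W,
      seidel_loop_energy R G W <= seidel_energy R G + d,
      seidel_energy R G - d = seidel_loop_energy R G W <->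
        sigma = 0%N \/ sigma = n
    & seidel_loop_energy R G W = seidel_energy R G + d <->
        sigma = 0%N \/ sigma = n].
Proof.
rewrite -{}card_W => d.
set c : R := #|W|%:R / n%:R; set v : 'rV[R]_n := loop_shift W.
have S_sym := trmx_seidel (R := R) G.
have L_sym := trmx_seidel_loop (R := R) G W.
have addE : seidel R G + 0%:M + diag_mx v = seidel_loop R G W + c%:M.
  by rewrite raddf0 addr0 seidel_add_loop_shift.
have subE : seidel_loop R G W + c%:M + diag_mx (- v) = seidel R G + 0%:M.
  by rewrite -addE raddfN /= addrK.
have v_sum : \sum_i `|v 0 i| = d by exact: sum_norm_loop_shift.
have Nv_sum : \sum_i `|(- v) 0 i| = d.
  by rewrite -v_sum; apply: eq_bigr => i _; rewrite mxE normrN.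
have d_eq0 : #|W| = 0%N \/ #|W| = n -> d = 0.
  rewrite /d => -[->|Wn]; first by rewrite mulr0 mul0r.
  (* An edge has an endpoint, so [n] is positive and n / n is 1. *)
  have [u [w _]] := G_nonempty.
  rewrite Wn divff ?subrr ?mulr0 // pnatr_eq0 -lt0n.
  exact: leq_ltn_trans (ltn_ord u).
have le_right := shifted_energy_addD_le S_sym L_sym addE.
have le_left := shifted_energy_addD_le L_sym S_sym subE.
rewrite seidel_energyE seidel_loop_energyE -/c.
rewrite v_sum in le_right; rewrite Nv_sum in le_left.
have [W01|W_int] : (#|W| = 0%N \/ #|W| = n) \/ (0 < #|W| < n)%N.
- have W_le : (#|W| <= n)%N by rewrite -[leqRHS]card_ord max_card.
  have [->|W_gt0] := posnP #|W|; first by left; left.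
  by move: W_le; rewrite leq_eqVlt => /orP[/eqP ->|W_ltn]; [left; right|right].
(* Here [d] is 0, so the two bounds pinch the energies together. *)
- rewrite d_eq0 // !(subr0, addr0) in le_right le_left *.
  by have -> : shifted_energy (seidel_loop R G W) c =
    shifted_energy (seidel R G) 0 by apply/le_anti; rewrite le_right.
have W01F : ~ (#|W| = 0%N \/ #|W| = n).
  by move=> [] W01; rewrite W01 ?ltnn ?andbF in W_int.
have v_neq0 i : v 0 i != 0 by exact: loop_shift_neq0.
have S_diag i : seidel R G i i = 0 by rewrite mxE eqxx.
have L_diag i : seidel_loop R G W i i + c = v 0 i.
  have /matrixP/(_ i i) := addE.
  rewrite mxE [(seidel R G + 0%:M) i i]mxE S_diag.
  by rewrite [RHS]mxE !(mxE _ _ i i) eqxx !mulr1n !add0r => ->.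
split; rewrite ?lerBlDr //; split=> // eq_energy; exfalso.
- have d_gt0 : 0 < d.
    case/andP: W_int => W_gt0 W_ltn.
    rewrite mulr_gt0 ?mulr_gt0 ?ltr0n // subr_gt0.
    rewrite ltr_pdivrMr ?mul1r ?ltr_nat //.
    by rewrite ltr0n (leq_trans W_gt0 (ltnW W_ltn)).
  (* Left equality is the equality case for the perturbation [- v] of the shifted loop matrix, whose
     diagonal is [v]. Its energy would be the sum of the -|v_i|, that is [- d] < 0. *)
  have eq_S : shifted_energy (seidel R G) 0 =
      shifted_energy (seidel_loop R G W) c + d by rewrite -eq_energy subrK.
  have := shifted_energy_addD_eq L_sym S_sym subE.
  rewrite Nv_sum => /(_ _ eq_S) L_energy.
  have : 0 <= shifted_energy (seidel_loop R G W) c by apply: sumr_ge0.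
  rewrite L_energy => [|i]; last by rewrite mxE oppr_eq0.
  under eq_bigr => i _ do
    rewrite [(- v) 0 i]mxE normrN L_diag invrN mulrN mulNr divfK //.
  by rewrite sumrN v_sum oppr_ge0 leNgt d_gt0.
(* Right equality: the Seidel matrix has zero diagonal, so its energy would be 0 and the matrix
   itself 0, against the existence of an edge. *)
- have := shifted_energy_addD_eq S_sym L_sym addE v_neq0.
  rewrite v_sum => /(_ eq_energy).
  under eq_bigr => i _ do rewrite S_diag addr0 mulr0.
  rewrite big1_eq => /(shifted_energy_eq0 _ _ _ S_sym); rewrite raddf0 addr0.
  exact/eqP/seidel_neq0.
Qed.
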